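(* Let $p$ be an odd prime with $p\equiv \pm 3 \pmod 8$, and let $G$ be a connected graph of order $n$, $n\geq 2$. If $G$ has size $n$, $n-1$ or $n+1$, then the corona graph $G\circ P_{p-1}$ is a Legendre cordial graph modulo $p$.
   Context: All graphs are finite, simple, and connected. The order and size of a graph are its number of vertices and its number of edges, respectively. $P_k$ denotes the path graph of order $k$, with vertex set $\{v_1,\ldots,v_k\}$ and edge set $\{v_1v_2,v_2v_3,\ldots,v_{k-1}v_k\}$. Corona: if $G_1$ has order $n$, the corona graph $G_1\circ G_2$ is obtained by taking one copy of $G_1$ and $n$ disjoint copies of $G_2$, and joining the $i$th vertex of $G_1$ to every vertex of the $i$th copy of $G_2$, for $i=1,\ldots,n$. Legendre symbol: for an odd prime $p$ and an integer $a$ relatively prime to $p$, $(a/p)=1$ if $x^2\equiv a\pmod p$ has a solution and $(a/p)=-1$ otherwise. Legendre cordial labeling: let $p$ be an odd prime and $H$ a simple connected graph of order $N$. A bijection $f:V(H)\to\{1,2,\ldots,N\}$ is a Legendre cordial labeling modulo $p$ if the induced function $f_p^*:E(H)\to\{0,1\}$, defined by $f_p^*(uv)=0$ if $([f(u)+f(v)]/p)=-1$ or $f(u)+f(v)\equiv 0\pmod p$, and $f_p^*(uv)=1$ if $([f(u)+f(v)]/p)=1$, satisfies $|e_{f_p^*}(0)-e_{f_p^*}(1)|\leq 1$, where $e_{f_p^*}(i)$ is the number of edges with label $i$ ($i=0,1$). A graph admitting such a labeling is called a Legendre cordial graph modulo $p$. *)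

(* Defs.v *)
From mathcomp Require Import all_boot all_order all_algebra.
Set Implicit Arguments.
Unset Strict Implicit.
Unset Printing Implicit Defensive.
Import Order.TTheory GRing.Theory Num.Theory.

Record sgraph := SGraph {
  vertex :> finType;
  adj : rel vertex;
  adj_sym : symmetric adj;
  adj_irrefl : irreflexive adj
}.

Definition edges (G : sgraph) : {set {set G}} :=
  [set [set x; y] | x in G, y in G & adj x y].

Definition connected (G : sgraph) : Prop :=
  forall x y : G, connect (@adj G) x y.

(* The vertex v_i is the ordinal of value i - 1. *)
Definition path_adj (k : nat) : rel 'I_k :=
  fun i j => (i.+1 == j :> nat) || (j.+1 == i :> nat).

Lemma path_adj_sym k : symmetric (@path_adj k).
Proof. by move=> i j; rewrite /path_adj orbC. Qed.

Lemma path_adj_irrefl k : irreflexive (@path_adj k).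
Proof. by move=> i; rewrite /path_adj orbb -{2}[val i]addn0 -addn1 eqn_add2l. Qed.

Definition path_graph (k : nat) : sgraph :=
  SGraph (@path_adj_sym k) (@path_adj_irrefl k).

(* inl x is the vertex x of G1, and inr (x, u) is the vertex u in the copy
   of G2 attached to x. *)
Definition corona_adj (G1 G2 : sgraph) : rel (G1 + G1 * G2)%type :=
  fun a b =>
    match a, b with
    | inl x, inl y => adj x y
    | inl x, inr (y, _) => x == y
    | inr (x, _), inl y => x == y
    | inr (x, u), inr (y, v) => (x == y) && adj u v
    end.

Lemma corona_adj_sym G1 G2 : symmetric (@corona_adj G1 G2).
Proof.
by move=> [x|[x u]] [y|[y v]] //=; rewrite 1?eq_sym // adj_sym.
Qed.

Lemma corona_adj_irrefl G1 G2 : irreflexive (@corona_adj G1 G2).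
Proof. by move=> [x|[x u]] /=; rewrite ?eqxx adj_irrefl. Qed.

Definition corona (G1 G2 : sgraph) : sgraph :=
  SGraph (@corona_adj_sym G1 G2) (@corona_adj_irrefl G1 G2).

(* Only meaningful when a is prime to p. A solution of the congruence can be
   searched for among the representatives 0, ..., p - 1. *)
Definition legendre (p : nat) (a : int) : int :=
  if [exists x : 'I_p, (Posz x ^+ 2 == a %[mod p])%Z] then 1%R else (-1)%R.

(* An edge is a pair {u, v} with u != v, so the sum below is f u + f v. *)
Definition edge_label (p : nat) (H : sgraph) (f : H -> nat) (e : {set H}) : nat :=
  let s := \sum_(w in e) f w in
  if (legendre p s == -1)%R || (s == 0 %[mod p]) then 0 else 1.

Definition label_count (p : nat) (H : sgraph) (f : H -> nat) (i : nat) : nat :=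
  #|[set e in edges H | edge_label p f e == i]|.

Definition legendre_cordial_labeling (p : nat) (H : sgraph) (f : H -> nat) : Prop :=
  [/\ injective f,
      forall k : nat, (exists v, f v = k) <-> 1 <= k <= #|H|
    & (`|(label_count p f 0)%:Z - (label_count p f 1)%:Z| <= 1)%R].

Definition legendre_cordial (p : nat) (H : sgraph) : Prop :=
  connected H /\ exists f : H -> nat, legendre_cordial_labeling p f.

(* Main.v *)
Require Import Defs.
From mathcomp Require Import all_boot all_order all_fingroup all_algebra.
From mathcomp Require Import all_solvable zify.

(** Write the vertices of the corona as pairs (x, t), where x is a vertex of G
    and t = 0, ..., p - 1 is a slot: slot 0 is x itself and slots 1, ..., p - 1
    are the successive vertices of the path attached to x.  Give the i-th vertex
    x, counting from i = 0, the block of labels i p + 1, ..., i p + p, and within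
    the block give slot t the label congruent to 4 t + 2 mod p.  As p is odd, the
    p slots get the p different residues, so this is a bijection onto
    1, ..., n p.

    Count each edge with the sign +1 if its label is 1 (the sum is a nonzero
    square mod p) and -1 otherwise.  The key fact is that 2, hence 8, is not a
    square when p is 3 or 5 mod 8, while 4 is one.  Half of the nonzero residues
    are squares and 0 counts -1, so the signs of all residues add up to -1.

    - An edge of G has sum 4, a square: these edges contribute |E(G)|.
    - The spokes at x have sums 4 k for k = 2, ..., p.  All residues appear but
      4, which has sign +1, so the contribution is -1 - 1 = -2.
    - The path edges at x have sums 8 k for k = 2, ..., p - 1.  All residues
      appear but 0 and 8, both of sign -1, so the contribution is -1 + 2 = 1.

    The total is |E(G)| - n, which lies between -1 and 1.

    The three counts are [label_sum_corona].  That 2 is a nonresidue is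
    [two_nonresidue_modn], proved by descent; that multiplication by a
    nonresidue exchanges squares and nonsquares ([is_square_nonsquareM]) comes
    from the cyclicity of the group of units. *)

Import GRing.Theory Num.Theory.
Set Implicit Arguments.
Unset Strict Implicit.

(** * Nonresidues and the sign of a residue *)

(** By descent.  Of the two roots r and n - r with 0 < r < n one is odd, as n is
    odd; call it b.  Then b^2 - 2 = q n is 7 mod 8, so q is again 3 or 5 mod 8, it
    is smaller than n, and 2 is a square mod q as well. *)
Lemma two_nonresidue_modn n a :
  n %% 8 = 3 \/ n %% 8 = 5 -> a ^ 2 <> 2 %[mod n].
Proof.
have [m] := ubnP n; elim: m n a => // m IH n a lt_nm n8 sq2.
have n_gt2 : 2 < n by case: n n8 {sq2 lt_nm} => [|[|[|n]]] //= [].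
have odd_n : odd n by move: n8; clear; lia.
have [b [lt_bn odd_b sqb]] : exists b, [/\ b < n, odd b & b ^ 2 = 2 %[mod n]].
  have lt_an : a %% n < n by rewrite ltn_mod (ltn_trans _ n_gt2).
  have sqr : (a %% n) ^ 2 = 2 %[mod n] by rewrite modnXm.
  move: (a %% n) lt_an sqr => r lt_rn sqr.
  have [odd_r|even_r] := boolP (odd r); first by exists r.
  have r_gt0 : 0 < r.
    by case: r sqr {lt_rn even_r} => // /eqP; rewrite mod0n modn_small.
  exists (n - r); split; first by rewrite ltn_subrL r_gt0 (ltn_trans _ n_gt2).
    by rewrite oddB ?(ltnW lt_rn) // odd_n (negbTE even_r).
  rewrite -sqr -(modnMDl (2 * r) ((n - _) ^ 2)) -[in RHS](modnMDl n (r ^ 2)).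
  have [k ->] : exists k, n = k + r by exists (n - r); rewrite subnK // ltnW.
  by congr (_ %% _); rewrite addnK; nia.
have b_gt1 : 1 < b.
  case: b odd_b sqb {lt_bn} => [|[|b]] // _.
  by rewrite exp1n !modn_small // ltnW.
have b2_ge2 : 2 <= b ^ 2 by rewrite (@leq_trans (2 ^ 2)) // leq_sqr.
have /dvdnP[q def_q] : n %| b ^ 2 - 2 by rewrite -eqn_mod_dvd // sqb.
have {def_q} def_b : b ^ 2 = q * n + 2 by rewrite -def_q subnK.
have lt_qn : q < n.
  rewrite -(ltn_pmul2r (ltn_trans (isT : 0 < 2) n_gt2)).
  rewrite (@leq_ltn_trans (b ^ 2)) ?def_b ?leq_addr //.
  by rewrite -def_b ltn_sqr.
apply: (IH q b (leq_trans lt_qn lt_nm)); last by rewrite def_b mulnC modnMDl.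
have b2_mod8 : b ^ 2 %% 8 = 1.
  rewrite -modnXm; have: odd (b %% 8) by rewrite odd_mod.
  by case: (b %% 8) (ltn_pmod b (isT : 0 < 8)) => [|[|[|[|[|[|[|[|?]]]]]]]].
move: b2_mod8; rewrite def_b -modnDml -modnMm.
case: (q %% 8) (ltn_pmod q (isT : 0 < 8)) => [|[|[|[|[|[|[|[|?]]]]]]]] //;
  by case: n8 => -> //= _ _; auto.
Qed.

Local Open Scope ring_scope.

Definition is_square (F : finFieldType) (a : F) : bool :=
  [exists x, x ^+ 2 == a].

Lemma nonsquare_neq0 (F : finFieldType) (a : F) : ~~ is_square a -> a != 0.
Proof.
by apply: contraNneq => ->; apply/existsP; exists 0; rewrite expr0n.
Qed.

Lemma is_squareMr (F : finFieldType) (a b : F) : b != 0 ->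
  is_square b -> is_square (b * a) = is_square a.
Proof.
move=> b0 /existsP[y /eqP def_b].
have y0 : y != 0 by apply: contraNneq b0 => y0; rewrite -def_b y0 expr0n.
apply/existsP/existsP=> [] [x /eqP def_x].
  by exists (x / y); rewrite expr_div_n def_x def_b mulrAC mulfV // mul1r.
by exists (y * x); rewrite exprMn def_x def_b.
Qed.

(** In the cyclic group of units, a nonsquare is an odd power of a generator, so
    a product of two of them is an even power. *)
Lemma nonsquareM (F : finFieldType) (a b : F) :
  ~~ is_square a -> ~~ is_square b -> is_square (a * b).
Proof.
move=> na nb; have [a0 b0] := (nonsquare_neq0 na, nonsquare_neq0 nb).
have /cyclicP[g gP] := field_unit_group_cyclic [set: {unit F}].
have powg (c : F) : c != 0 -> exists i, c = val g ^+ i.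
  rewrite -unitfE => uc; have : FinRing.unit F uc \in <[g]>%g by rewrite -gP inE.
  by move=> /cycleP[i ci]; exists i; rewrite -FinRing.val_unitX -ci.
have [[i def_a] [j def_b]] := (powg a a0, powg b b0).
have odd_exp (c : F) k : ~~ is_square c -> c = val g ^+ k -> odd k.
  move=> nc def_c; apply: contraNT nc => even_k; apply/existsP.
  by exists (val g ^+ k./2); rewrite -exprM muln2 even_halfK // -def_c.
apply/existsP; exists (val g ^+ (i + j)./2).
rewrite -exprM muln2 even_halfK; last by rewrite oddD (odd_exp a) ?(odd_exp b).
by rewrite exprD -def_a -def_b.
Qed.

Lemma is_square_nonsquareM (F : finFieldType) (c a : F) :
  ~~ is_square c -> a != 0 -> is_square (c * a) = ~~ is_square a.
Proof.
move=> nc a0; have [sa|na] := boolP (is_square a); last exact: nonsquareM.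
by rewrite mulrC is_squareMr //; apply: negbTE.
Qed.

(** The sign of 0 is -1, because an edge whose sum vanishes mod p is labeled 0. *)
Definition label_sign (F : finFieldType) (a : F) : int :=
  if (a != 0) && is_square a then 1 else -1.

(** Multiplication by a nonsquare permutes the nonzero elements and flips their
    signs, so these signs cancel; what is left is the sign -1 of 0. *)
Lemma sum_label_sign (F : finFieldType) (c : F) : ~~ is_square c ->
  \sum_(a : F) label_sign a = -1.
Proof.
move=> nc; have c0 := nonsquare_neq0 nc.
rewrite (bigD1 0) //= /label_sign eqxx /=.
set S := \sum_(a | _) _.
suff: S = - S by lia.
rewrite {1}/S (reindex_inj (mulfI c0)) /= -sumrN.
apply: eq_big => a; first by rewrite mulf_eq0 (negbTE c0).
rewrite mulf_eq0 (negbTE c0) /= => a0.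
by rewrite a0 is_square_nonsquareM //=; case: is_square.
Qed.

Lemma eqr_nat_Fp p (p_pr : prime p) m n :
  (m%:R == n%:R :> 'F_p) = (m == n %[mod p]).
Proof. by rewrite -val_eqE /= !val_Fp_nat. Qed.

Lemma sum_Fp_nat p (p_pr : prime p) (F : 'F_p -> int) c : c%:R != 0 :> 'F_p ->
  \sum_(k < p) F (c * k)%:R = \sum_a F a.
Proof.
move=> c0; have inj : injective (fun k : 'I_p => (c * k)%:R : 'F_p).
  move=> i j /=; rewrite !natrM => /(mulfI c0)/eqP.
  by rewrite eqr_nat_Fp // !modn_small // => /eqP/val_inj.
have bij := inj_card_bij inj.
by rewrite [RHS](reindex _ (onW_bij _ (bij _))) // card_Fp // card_ord.
Qed.

(** * Sums over adjacent pairs *)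

(** Each edge is met twice, as (x, y) and as (y, x).  Passing to ordered pairs
    removes sets of sets from all further counting. *)
Lemma sum_adj_edges (H : sgraph) (F : {set H} -> int) :
  \sum_x \sum_(y | adj x y) F [set x; y] = (\sum_(e in edges H) F e) *+ 2.
Proof.
have edgeP e : e \in edges H -> exists x y : H, adj x y /\ e = [set x; y].
  by case/imset2P=> x y _; rewrite !inE => xy ->; exists x, y.
rewrite pair_big_dep /=.
rewrite (partition_big (fun u => [set u.1; u.2]) (mem (edges H))) /=; last first.
  by move=> [x y] /= xy; apply/imset2P; exists x y; rewrite ?inE.
rewrite -sumrMnl; apply: eq_bigr => e /edgeP[x [y [xy def_e]]].
have neq_xy : x != y by apply: contraTneq xy => ->; rewrite adj_irrefl.
rewrite (eq_bigr (fun=> F e)) => [|u /andP[_ /eqP->] //].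
rewrite sumr_const; congr (_ *+ _).
have <- : #|[set (x, y); (y, x)]| = 2%N.
  by rewrite cards2 xpair_eqE (negbTE neq_xy).
apply: eq_card => -[u v]; rewrite !inE /= !xpair_eqE def_e.
apply/andP/orP => [[uv /eqP eq_uv]|].
  have : u \in [set x; y] by rewrite -eq_uv !inE eqxx.
  have : v \in [set x; y] by rewrite -eq_uv !inE eqxx orbT.
  move=> /set2P[] def_v /set2P[] def_u; move: uv;
    rewrite def_v def_u ?adj_irrefl // => _.
    by right; rewrite !eqxx.
  by left; rewrite !eqxx.
by case=> /andP[/eqP-> /eqP->]; [|rewrite adj_sym setUC].
Qed.

Lemma sum_path_adj k (F : nat -> nat -> int) :
  \sum_(i < k.+1) \sum_(j < k.+1 | path_adj i j) F i j
  = \sum_(i < k) (F i i.+1 + F i.+1 i).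
Proof.
have split_adj (i : 'I_k.+1) : \sum_(j < k.+1 | path_adj i j) F i j =
    \sum_(j < k.+1 | j == i.+1 :> nat) F i j +
    \sum_(j < k.+1 | i == j.+1 :> nat) F i j.
  rewrite (bigID (fun j : 'I_k.+1 => j == i.+1 :> nat)) /=.
  congr (_ + _); apply: eq_bigl => j; rewrite /path_adj; lia.
rewrite (eq_bigr _ (fun i _ => split_adj i)) !big_split /=; congr (_ + _).
  rewrite big_ord_recr /= [X in _ + X]big1 ?addr0 => [|j /eqP j_k]; last first.
    by have := ltn_ord j; rewrite j_k ltnn.
  by apply: eq_bigr => i _; rewrite (big_ord1_eq _ (F i)) ltnS ltn_ord.
rewrite (exchange_big_dep predT) //= big_ord_recr /=.
rewrite [X in _ + X]big1 ?addr0 => [|j /eqP j_k]; last first.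
  by have := ltn_ord j; rewrite j_k ltnn.
by apply: eq_bigr => i _; rewrite (big_ord1_eq _ (F^~ i)) ltnS ltn_ord.
Qed.

Lemma corona_connected (G1 G2 : sgraph) :
  connected G1 -> connected (corona G1 G2).
Proof.
move=> conG.
have conl x y : connect (@adj (corona G1 G2)) (inl x) (inl y).
  have /connectP[s xs ->] := conG x y.
  apply/connectP; exists (map inl s); last by rewrite last_map.
  by rewrite path_map.
pose root (a : corona G1 G2) := match a with inl x => x | inr (x, _) => x end.
have con_root a : connect (@adj (corona G1 G2)) a (inl (root a)).
  by case: a => [x|[x u]] //; apply: connect1 => /=.
move=> a b; apply: connect_trans (con_root a) _.
apply: connect_trans (conl _ (root b)) _.
by rewrite (sym_connect_sym (@adj_sym (corona G1 G2))).
Qed.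

(** Spokes run between the two summands of the vertex type, so they are met from
    both sides; symmetry of F folds the two sides into the factor 2. *)
Lemma sum_corona_adj (G1 G2 : sgraph)
  (F : corona G1 G2 -> corona G1 G2 -> int) :
  (forall a b, F a b = F b a) ->
  \sum_a \sum_(b | adj a b) F a b =
  \sum_x \sum_(y | adj x y) F (inl x) (inl y) +
  \sum_x ((\sum_u F (inl x) (inr (x, u))) *+ 2
          + \sum_u \sum_(v | adj u v) F (inr (x, u)) (inr (x, v))).
Proof.
move=> F_sym.
have sum_pair (E : G1 * G2 -> int) : \sum_q E q = \sum_x \sum_u E (x, u).
  by rewrite (pair_bigA _ (fun x u => E (x, u))); apply: eq_bigr => -[].
have at_x x (E : G1 -> int) : \sum_y (if x == y then E y else 0) = E x.
  by rewrite -big_mkcond (big_pred1 x) // => y; rewrite eq_sym.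
have spoke x : \sum_(b | adj (inl x : corona G1 G2) b) F (inl x) b =
    \sum_(y | adj x y) F (inl x) (inl y) + \sum_u F (inl x) (inr (x, u)).
  rewrite big_sumType; congr (_ + _).
  rewrite big_mkcond sum_pair exchange_big; apply: eq_bigr => u _.
  exact: at_x.
have copy x u : \sum_(b | adj (inr (x, u) : corona G1 G2) b) F (inr (x, u)) b =
    F (inl x) (inr (x, u)) + \sum_(v | adj u v) F (inr (x, u)) (inr (x, v)).
  rewrite big_sumType F_sym; congr (_ + _).
    by rewrite big_mkcond; exact: at_x.
  rewrite big_mkcond sum_pair exchange_big [RHS]big_mkcond.
  apply: eq_bigr => v _.
  pose E y := if adj u v then F (inr (x, u)) (inr (y, v)) else 0.
  rewrite -[RHS](at_x x E).
  by apply: eq_bigr => y _ /=; case: eqP.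
rewrite big_sumType /= sum_pair.
rewrite (eq_bigr _ (fun x _ => spoke x)) big_split /= -addrA.
congr (_ + _); rewrite -big_split; apply: eq_bigr => x _ /=.
by rewrite (eq_bigr _ (fun u _ => copy x u)) big_split /= addrA.
Qed.

(** * Edge labels as signs *)

(** This moves the Legendre symbol from integer representatives to the field
    'F_p, where squares can be counted. *)
Lemma edge_labelE (p : nat) (p_pr : prime p) (H : sgraph) (f : H -> nat) x y :
  x != y ->
  let s : 'F_p := (f x + f y)%:R in
  edge_label p f [set x; y] = (s != 0) && is_square s :> nat.
Proof.
move=> neq_xy /=; rewrite /edge_label big_setU1 ?inE //= big_set1.
set s := (f x + f y)%N.
have -> : (legendre p s == -1) = ~~ is_square (s%:R : 'F_p).
  rewrite /legendre.
  suff -> : [exists x : 'I_p, (Posz x ^+ 2 == s %[mod p])%Z] =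
            is_square (s%:R : 'F_p).
    by case: is_square.
  have natE (k : nat) :
      (Posz k ^+ 2 == s %[mod p])%Z = ((k%:R : 'F_p) ^+ 2 == s%:R).
    rewrite -natrX eqr_nat_Fp //.
    by rewrite -[Posz k ^+ 2]/(Posz (k * k)) mulnn !modz_nat.
  apply/existsP/existsP => [[k]|[k kk]]; first by rewrite natE; exists k%:R.
  have ltkp : (k < p)%N by rewrite -[X in (_ < X)%N](card_Fp p_pr) card_ord.
  by exists (Ordinal ltkp); rewrite natE /= natr_Zp.
rewrite -(eqr_nat_Fp p_pr).
by case: is_square; case: eqP.
Qed.

Lemma label_countB (p : nat) (p_pr : prime p) (H : sgraph) (f : H -> nat) :
  ((label_count p f 1)%:Z - (label_count p f 0)%:Z) *+ 2 =
  \sum_x \sum_(y | adj x y) label_sign ((f x + f y)%:R : 'F_p).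
Proof.
pose sg (e : {set H}) : int :=
  (edge_label p f e == 1%N)%:Z - (edge_label p f e == 0%N)%:Z.
transitivity (\sum_x \sum_(y : H | adj x y) sg [set x; y]).
  rewrite sum_adj_edges; congr (_ *+ 2).
  rewrite /sg sumrB /label_count.
  have count i : (#|[set e in edges H | edge_label p f e == i]|)%:Z =
     \sum_(e in edges H) (edge_label p f e == i)%:Z.
    rewrite -sum1_card -natz natr_sum big_mkcond [RHS]big_mkcond.
    by apply: eq_bigr => e _; rewrite inE; case: (e \in _); case: (_ == i).
  by rewrite !count.
apply: eq_bigr => x _; apply: eq_bigr => y xy.
have neq_xy : x != y by apply: contraTneq xy => ->; rewrite adj_irrefl.
by rewrite /sg edge_labelE // /label_sign; case: (_ && _).
Qed.

(** * The labeling of the corona *)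

Definition slot (G : sgraph) (k : nat) (a : corona G (path_graph k)) : G * nat :=
  match a with inl x => (x, 0%N) | inr (x, j) => (x, (j : 'I_k).+1) end.

(** The remainder is taken of 4 t + 1 before adding 1, so that labels in a block
    run over 1, ..., p and not over 0, ..., p - 1. *)
Definition corona_label (p : nat) (G : sgraph)
    (a : corona G (path_graph (p - 1))) : nat :=
  let: (x, t) := slot a in (enum_rank x * p + ((4 * t + 1) %% p).+1)%N.

Lemma slot_inj G k : injective (@slot G k).
Proof.
move=> [x|[x i]] [y|[y j]] //= [-> //] eq_ij.
by congr (inr (_, _)); apply: val_inj.
Qed.

Lemma slot_le G k (a : corona G (path_graph k)) : ((slot a).2 <= k)%N.
Proof. by case: a => [x|[x [j]]]. Qed.

(** The quotient by p recovers the vertex of G, and since 4 is invertible mod p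
    the remainder recovers the slot. *)
Lemma corona_label_inj (p : nat) (G : sgraph) :
  prime p -> 2%:R != 0 :> 'F_p -> injective (@corona_label p G).
Proof.
move=> p_pr nz2; have p_gt0 := prime_gt0 p_pr; move=> a b eq_ab; apply: slot_inj.
have := slot_le a; have := slot_le b; move: eq_ab; rewrite /corona_label.
case: (slot a) (slot b) => [x t] [y u] /= eq_f u_le t_le.
have [eq_xy] : enum_rank x = enum_rank y :> nat /\
    ((4 * t + 1) %% p = (4 * u + 1) %% p)%N.
  move: eq_f; rewrite !addnS => -[eq_f]; split.
    have := congr1 (divn^~ p) eq_f.
    by rewrite !divnMDl // !(divn_small (ltn_pmod _ _)) ?addn0.
  by have := congr1 (modn^~ p) eq_f; rewrite !modnMDl !modn_mod.
move/eqP; rewrite eqn_modDr -!(eqr_nat_Fp p_pr) !natrM => /eqP /mulfI eq_tu.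
have /eqP : (t%:R == u%:R :> 'F_p).
  by apply/eqP/eq_tu; rewrite (natrM _ 2 2) mulf_neq0.
have lt_p k : (k <= p - 1 -> k < p)%N by rewrite -ltnS subn1 prednK.
move/eqP; rewrite eqr_nat_Fp // !modn_small ?lt_p // => /eqP ->.
by rewrite (enum_rank_inj (val_inj eq_xy)).
Qed.

Lemma corona_label_bounds (p : nat) (G : sgraph) a : (0 < p)%N ->
  (1 <= @corona_label p G a <= #|G| * p)%N.
Proof.
move=> p_gt0; rewrite /corona_label; case: (slot a) => x t.
rewrite addnS /=; have := ltn_pmod (4 * t + 1) p_gt0; have := ltn_ord (enum_rank x).
move=> lt_k lt_r; rewrite (leq_trans _ (leq_mul lt_k (leqnn p))) //.
by rewrite mulSn addnC ltn_add2r.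
Qed.

Lemma card_corona (G1 G2 : sgraph) : #|corona G1 G2| = (#|G1| * #|G2|.+1)%N.
Proof. by rewrite card_sum card_prod mulnS. Qed.

Lemma range_of_injective (T : finType) (f : T -> nat) :
  injective f -> (forall v, (1 <= f v <= #|T|)%N) ->
  forall k, (exists v, f v = k) <-> (1 <= k <= #|T|)%N.
Proof.
move=> f_inj f_bd k; split=> [[v <-] //|/andP[k_gt0 k_le]].
have lt_f v : ((f v).-1 < #|T|)%N by have := f_bd v; lia.
have g_inj : injective (fun v => Ordinal (lt_f v)).
  move=> u v [eq_uv]; apply: f_inj; have := f_bd u; have := f_bd v; lia.
have [|h _ gK] := inj_card_bij g_inj; first by rewrite card_ord.
have lt_k : (k.-1 < #|T|)%N by lia.
have /(congr1 val) /= := gK (Ordinal lt_k).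
by move: (h _) => v eq_v; exists v; have := f_bd v; lia.
Qed.

(** At each vertex of G the spokes weigh -2 and the path edges +1, which leaves
    -1 per vertex.  Everything is doubled because ordered pairs are summed. *)
Lemma label_sum_corona p (G : sgraph) (p_pr : prime p) :
  ~~ is_square (2 : 'F_p) ->
  \sum_a \sum_(b | adj a b)
     label_sign ((@corona_label p G a + @corona_label p G b)%:R : 'F_p)
  = ((#|edges G|)%:Z - #|G|%:Z) *+ 2.
Proof.
case: p p_pr => [|[|q]] // p_pr; set p := q.+2 => nsq2.
have nz2 := nonsquare_neq0 nsq2.
have label_Fp a : (@corona_label p G a)%:R = (4 * (slot a).2 + 2)%:R :> 'F_p.
  rewrite /corona_label; case: (slot a) => x t /=; apply/eqP.
  by rewrite eqr_nat_Fp // modnMDl -addn1 modnDml -addnA.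
have sumE (c : nat) : c%:R != 0 :> 'F_p ->
    \sum_(k < p) label_sign ((c * k)%:R : 'F_p) = -1.
  by move=> nzc; rewrite (sum_Fp_nat p_pr) // (sum_label_sign nsq2).
have nz4 : 4%:R != 0 :> 'F_p by rewrite (natrM _ 2 2) mulf_neq0.
have nz8 : 8%:R != 0 :> 'F_p by rewrite (natrM _ 2 4) mulf_neq0.
have sq4 : label_sign (4%:R : 'F_p) = 1.
  by rewrite /label_sign nz4 ifT //; apply/existsP; exists 2; rewrite -natrX.
have nsq8 : label_sign (8%:R : 'F_p) = -1.
  rewrite /label_sign (natrM _ 4 2) is_squareMr ?(negbTE nsq2) ?andbF //.
  by apply/existsP; exists 2; rewrite -natrX.
have sign0 : label_sign (0 : 'F_p) = -1 by rewrite /label_sign eqxx.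
(* The residues 0 and c are left out of the full sum; 0 alone makes up the -1. *)
have sum2E (c : nat) : c%:R != 0 :> 'F_p ->
    \sum_(k < q) label_sign ((c * k.+2)%:R : 'F_p) = - label_sign (c%:R : 'F_p).
  move=> /sumE; rewrite /p 2!big_ord_recl /= muln0 muln1 sign0.
  by rewrite /bump /=; under eq_bigr do rewrite !add1n; lia.
pose sg a b := label_sign ((@corona_label p G a + @corona_label p G b)%:R : 'F_p).
have sgE a b (k : nat) :
    ((4 * (slot a).2 + 2) + (4 * (slot b).2 + 2))%N = k ->
    sg a b = label_sign (k%:R : 'F_p).
  by move=> <-; rewrite /sg natrD !label_Fp -natrD.
rewrite (sum_corona_adj (F := sg)) => [|a b]; last by rewrite /sg addnC.
have -> : \sum_x \sum_(y | adj x y) sg (inl x) (inl y) = (#|edges G|)%:Z *+ 2.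
  have -> : (#|edges G|)%:Z = \sum_(e in edges G) 1 by rewrite sumr_const natz.
  rewrite -sum_adj_edges.
  by apply: eq_bigr => x _; apply: eq_bigr => y _; rewrite (sgE _ _ 4%N).
rewrite mulrnBl; congr (_ + _).
have -> : #|G|%:Z = \sum_(x : G) 1 by rewrite sumr_const natz.
rewrite -sumrMnl -sumrN; apply: eq_bigr => x _.
have -> : \sum_u sg (inl x) (inr (x, u)) = - 2.
  transitivity (\sum_(u < q.+1) label_sign ((4 * u.+2)%:R : 'F_p)).
    by apply: eq_bigr => -[u lt_u] _; apply: sgE; rewrite /=; lia.
  have p0 : label_sign ((4 * q.+2)%:R : 'F_p) = -1.
    have /eqP -> : (4 * q.+2)%:R == 0%:R :> 'F_p.
      by rewrite eqr_nat_Fp // modnMl mod0n.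
    exact: sign0.
  by rewrite big_ord_recr /= p0 (sum2E 4%N nz4) sq4.
have -> : \sum_(u : path_graph (p - 1)) \sum_(v | adj u v)
    sg (inr (x, u)) (inr (x, v)) = 2.
  pose F i j := label_sign ((4 * (i + j).+3)%:R : 'F_p).
  transitivity (\sum_(i < q.+1) \sum_(j < q.+1 | path_adj i j) F i j).
    apply: eq_bigr => -[u lt_u] _; apply: eq_bigr => -[v lt_v] _.
    by apply: sgE; rewrite /=; lia.
  pose E (i : nat) := label_sign ((8 * i.+2)%:R : 'F_p).
  rewrite sum_path_adj (eq_bigr (fun i : 'I_q => E i *+ 2)) => [|i _]; last first.
    by rewrite /E /F mulr2n; congr (label_sign _%:R + label_sign _%:R); lia.
  by rewrite sumrMnl (sum2E 8%N nz8) nsq8.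
by [].
Qed.

Local Close Scope ring_scope.
Unset Implicit Arguments.
Set Strict Implicit.

Theorem theorem3p1 (p : nat) (p_prime : prime p) (p_odd : odd p)
    (p_mod8 : (Posz p = 3 %[mod 8])%Z \/ (Posz p = - 3 %[mod 8])%Z)
    (G : sgraph) (G_connected : connected G)
    (n : nat) (G_order : #|G| = n) (n_ge2 : 2 <= n)
    (G_size : [\/ #|edges G| = n, #|edges G| = n - 1 | #|edges G| = n + 1]) :
  legendre_cordial p (corona G (path_graph (p - 1))).
Proof.
have p_gt0 := prime_gt0 p_prime.
have nsq2 : ~~ is_square (2%:R : 'F_p)%R.
  apply/existsP => -[k /eqP sq_k].
  apply: (@two_nonresidue_modn p k); first by case: p_mod8 => /eqP; lia.
  by apply/eqP; rewrite -(eqr_nat_Fp p_prime) natrX natr_Zp sq_k.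
have inj_f := corona_label_inj (G := G) p_prime (nonsquare_neq0 nsq2).
have card_H : #|corona G (path_graph (p - 1))| = #|G| * p.
  by rewrite card_corona card_ord subn1 prednK.
split; first exact: corona_connected.
exists (@corona_label p G); split => //.
  apply: range_of_injective => // v.
  by rewrite card_H corona_label_bounds.
have := label_countB p_prime (@corona_label p G).
rewrite label_sum_corona // => eq_count.
by move: G_size eq_count; rewrite -G_order; case=> ->; lia.
Qed.
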